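(* Let $\varphi\in\mathcal{W}$, $\varphi(\zeta)=\sum_{n=-\infty}^\infty c_n\zeta^n$ for $\zeta=e^{ix}\in\mathbb{T}$, with $\sum_n|c_n|<\infty$. Then for every $z\in\mathbb{T}$ the principal value integral below exists and $$\mathrm{V.P.}\frac1\pi\int_{\mathbb{T}}\frac{\varphi(\zeta)}{\zeta-z}\,d\zeta=i\sum_{n=-\infty}^\infty\eta_n c_n z^n,$$ where $\eta_n=1$ for $n\ge 0$ and $\eta_n=-1$ for $n<0$.
   Context: $\mathbb{T}=\{\zeta\in\mathbb{C}:|\zeta|=1\}$, oriented counterclockwise. $\mathcal{W}$ is the Wiener algebra of continuous $2\pi$-periodic functions $\varphi(x)=\sum_{n\in\mathbb{Z}}c_ne^{inx}$ with $\sum_n|c_n|<\infty$, identified with functions $\varphi(\zeta)=\sum_n c_n\zeta^n$ on $\mathbb{T}$ through $\zeta=e^{ix}$. For $z\in\mathbb{T}$, $\mathrm{V.P.}\int_{\mathbb{T}}(\cdot)\,d\zeta=\lim_{\varepsilon\to+0}\int_{\{\zeta\in\mathbb{T}:\,|\zeta-z|\ge\varepsilon\}}(\cdot)\,d\zeta$. *)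

(* Defs.v *)
From Stdlib Require Import Reals ZArith.
From Coquelicot Require Import Coquelicot.

Open Scope R_scope.

Definition unit_circle (zeta : C) : Prop := Cmod zeta = 1.

Definition Cexpi (x : R) : C := (cos x, sin x).

Definition Cpowz (z : C) (n : Z) : C :=
  match n with
  | Z0 => RtoC 1
  | Zpos p => Cpow z (Pos.to_nat p)
  | Zneg p => Cinv (Cpow z (Pos.to_nat p))
  end.

(* Convergence of a two-sided series means convergence of both halves,
   n >= 0 and n <= -1. *)
Definition is_Zseries {K : AbsRing} {V : NormedModule K} (a : Z -> V) (l : V)
  : Prop :=
  exists lp ln : V,
    is_series (fun k : nat => a (Z.of_nat k)) lp /\
    is_series (fun k : nat => a (- Z.of_nat (S k))%Z) ln /\
    l = plus lp ln.

Definition ex_Zseries {K : AbsRing} {V : NormedModule K} (a : Z -> V) : Prop :=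
  exists l : V, is_Zseries a l.

Definition abs_summable (c : Z -> C) : Prop :=
  ex_Zseries (V := R_NormedModule) (fun n => Cmod (c n)).

Definition abs_Laurent_expansion (c : Z -> C) (phi : C -> C) : Prop :=
  abs_summable c /\
  forall zeta : C, unit_circle zeta ->
    is_Zseries (V := C_NormedModule)
      (fun n => (c n * Cpowz zeta n)%C) (phi zeta).

(* Functions on the circle are maps [C -> C] of which only the values on
   [unit_circle] are used; the 2*PI-periodic function attached to [phi] is
   [fun x => phi (Cexpi x)]. *)
Definition in_Wiener (phi : C -> C) : Prop :=
  continuous_on unit_circle phi /\
  exists c : Z -> C, abs_Laurent_expansion c phi.

(* [Il] is the contour integral of [f] over the part of the circle at distance
   at least [eps] from [z], for zeta = e^(ix), dzeta = i e^(ix) dx and [x] going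
   from 0 to 2 PI, i.e. counterclockwise.  The value of [f] at [z] is
   irrelevant when [0 < eps]. *)
Definition is_truncated_circle_int (f : C -> C) (z : C) (eps : R) (Il : C)
  : Prop :=
  is_RInt (V := C_R_NormedModule)
    (fun x =>
       let zeta := Cexpi x in
       if Rle_dec eps (Cmod (zeta - z)%C)
       then (f zeta * (Ci * zeta))%C
       else RtoC 0)
    0 (2 * PI) Il.

Definition is_VP_circle_int (f : C -> C) (z : C) (l : C) : Prop :=
  exists F : R -> C,
    (forall eps : R, 0 < eps -> is_truncated_circle_int f z eps (F eps)) /\
    filterlim F (at_right 0) (locally l).

Definition eta (n : Z) : C := if Z_le_dec 0 n then RtoC 1 else RtoC (-1).

(* Main.v *)
Require Import Defs.
From Stdlib Require Import Reals ZArith Lra Lia.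
From Coquelicot Require Import Coquelicot.

(* With z = e^(it) and zeta = z e^(iy), the terms of index k and -(k+1) of the
   Laurent series produce the kernels e^(+-i(k+1/2)y) / (2 sin (y/2)), whose real
   part is odd about y = PI and whose imaginary part is +-D_k(y)/2, with D_k the
   Dirichlet kernel.  Hence the integral of this pair over d <= y <= 2 PI - d is
     i (c_k z^k - c_(-k-1) z^(-k-1)) * A_k(d),
   where A_k(d) is the integral of D_k from d to PI.  For a fixed truncation the
   series converges uniformly, which allows termwise integration.  Since
   A_k(d) -> PI as d -> 0 for each k, and |A_k| <= 12 uniformly in k and d, the
   resulting series converges uniformly in the truncation parameter, and the
   limit may be taken term by term. *)

Open Scope R_scope.

(** * The Dirichlet kernel and bounds for its tail integrals *)

Fixpoint dirichlet (k : nat) (x : R) : R :=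
  match k with
  | O => 1
  | S k' => dirichlet k' x + 2 * cos (INR k * x)
  end.

(* The integral of [dirichlet k] from [x] to [PI], in closed form. *)
Fixpoint dirichlet_tail (k : nat) (x : R) : R :=
  match k with
  | O => PI - x
  | S k' => dirichlet_tail k' x - 2 * sin (INR k * x) / INR k
  end.

(** Telescoping: sin (a + x/2) - sin (a - x/2) = 2 sin (x/2) cos a with a = (k+1) x. The product
    form avoids dividing by sin (x/2), which may vanish. *)
Lemma dirichlet_closed_form (k : nat) (x : R) :
  sin (x / 2) * dirichlet k x = sin ((INR k + / 2) * x).
Proof.
induction k as [|k IH].
- simpl dirichlet. rewrite Rmult_1_r. f_equal. simpl; field.
- change (dirichlet (S k) x) with (dirichlet k x + 2 * cos (INR (S k) * x)).
  rewrite Rmult_plus_distr_l, IH, S_INR.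
  replace ((INR k + / 2) * x) with ((INR k + 1) * x - x / 2) by field.
  replace ((INR k + 1 + / 2) * x) with ((INR k + 1) * x + x / 2) by field.
  rewrite sin_minus, sin_plus. ring.
Qed.

Lemma is_derive_dirichlet_tail (k : nat) (x : R) :
  is_derive (dirichlet_tail k) x (- dirichlet k x).
Proof.
induction k as [|k IH].
- simpl. auto_derive; [easy | ring].
- assert (Hk : INR (S k) <> 0) by (apply not_0_INR; lia).
  change (is_derive (fun y => dirichlet_tail k y - 2 * sin (INR (S k) * y) / INR (S k)) x
    (- (dirichlet k x + 2 * cos (INR (S k) * x)))).
  replace (- (dirichlet k x + 2 * cos (INR (S k) * x)))
    with (minus (- dirichlet k x) (2 * cos (INR (S k) * x)))
    by (unfold minus, plus, opp; simpl; ring).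
  apply (is_derive_minus (dirichlet_tail k)
    (fun y => 2 * sin (INR (S k) * y) / INR (S k)) x); [exact IH|].
  revert Hk; generalize (INR (S k)); intros m Hk.
  auto_derive; [easy | field; exact Hk].
Qed.

Lemma continuous_dirichlet (k : nat) (x : R) : continuous (dirichlet k) x.
Proof.
induction k as [|k IH].
- apply continuous_const.
- apply (continuous_plus (dirichlet k) (fun y => 2 * cos (INR (S k) * y)) x); [exact IH|].
  apply (ex_derive_continuous (fun y => 2 * cos (INR (S k) * y))). auto_derive; easy.
Qed.

Lemma sin_INR_PI (k : nat) : sin (INR k * PI) = 0.
Proof. apply sin_eq_0_1. exists (Z.of_nat k). now rewrite <- INR_IZR_INZ. Qed.

Lemma dirichlet_tail_PI (k : nat) : dirichlet_tail k PI = 0.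
Proof.
induction k as [|k IH]; [simpl; ring|].
change (dirichlet_tail k PI - 2 * sin (INR (S k) * PI) / INR (S k) = 0).
rewrite IH, sin_INR_PI. unfold Rdiv; ring.
Qed.

(** D_k is symmetric about PI, so its primitive vanishing at PI is antisymmetric there. *)
Lemma dirichlet_tail_reflect (k : nat) (x : R) :
  dirichlet_tail k (2 * PI - x) = - dirichlet_tail k x.
Proof.
induction k as [|k IH]; [simpl; ring|].
change (dirichlet_tail k (2 * PI - x) - 2 * sin (INR (S k) * (2 * PI - x)) / INR (S k)
  = - (dirichlet_tail k x - 2 * sin (INR (S k) * x) / INR (S k))).
rewrite IH.
replace (INR (S k) * (2 * PI - x)) with (- (INR (S k) * x) + 2 * INR (S k) * PI) by ring.
rewrite sin_period, sin_neg. unfold Rdiv; ring.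
Qed.

Lemma Rabs_sin_le (x : R) : 0 <= x -> Rabs (sin x) <= x.
Proof.
intros Hx.
replace x with (1 * Rabs (x - 0)) at 2 by (rewrite Rminus_0_r, Rabs_pos_eq; lra).
replace (sin x) with (sin x - sin 0) by (rewrite sin_0; ring).
apply (bounded_variation sin cos). intros t _. split.
- auto_derive; [easy | ring].
- apply Rabs_le. generalize (COS_bound t); lra.
Qed.

(** The value at 0 is PI, and each sine term contributes at most 2 x because |sin u| <= u. This
    gives the limit for fixed k, and also the uniform bound as long as x is of order 1/k. *)
Lemma dirichlet_tail_near_0 (k : nat) (x : R) :
  0 <= x -> Rabs (dirichlet_tail k x - PI) <= (2 * INR k + 1) * x.
Proof.
intros Hx. induction k as [|k IH].
- simpl. replace (PI - x - PI) with (- x) by ring.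
  rewrite Rabs_Ropp, Rabs_pos_eq; lra.
- assert (Hk : 0 < INR (S k)) by (apply lt_0_INR; lia).
  change (Rabs (dirichlet_tail k x - 2 * sin (INR (S k) * x) / INR (S k) - PI)
    <= (2 * INR (S k) + 1) * x).
  replace (dirichlet_tail k x - 2 * sin (INR (S k) * x) / INR (S k) - PI)
    with (dirichlet_tail k x - PI + - (2 / INR (S k) * sin (INR (S k) * x))) by (field; lra).
  eapply Rle_trans; [apply Rabs_triang|].
  rewrite Rabs_Ropp, Rabs_mult, (Rabs_pos_eq (2 / INR (S k)))
    by (apply Rlt_le, Rdiv_lt_0_compat; lra).
  assert (H : 2 / INR (S k) * Rabs (sin (INR (S k) * x)) <= 2 / INR (S k) * (INR (S k) * x)).
  { apply Rmult_le_compat_l; [apply Rlt_le, Rdiv_lt_0_compat; lra|].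
    apply Rabs_sin_le. apply Rmult_le_pos; lra. }
  replace (2 / INR (S k) * (INR (S k) * x)) with (2 * x) in H by (field; lra).
  replace (2 * INR (S k) + 1) with (2 * INR k + 1 + 2) by (rewrite S_INR; ring). lra.
Qed.

(** From sin x >= x - x^3/6 and x <= 2, which follows from PI <= 4: the factor is 1 - 4/6 = 1/3. Any
    linear lower bound would serve. *)
Lemma sin_ge_third (x : R) : 0 <= x <= PI / 2 -> x / 3 <= sin x.
Proof.
intros [H0 H1].
assert (HP : PI <= 4) by apply PI_4.
destruct (sin_bound x 0) as [H _]; [lra | lra |].
apply Rle_trans with (2 := H).
unfold sin_approx, sin_term. simpl.
assert (x * (x * x) <= x * 4) by (apply Rmult_le_compat_l; nra).
lra.
Qed.

Lemma nonincreasing_of_derive (f df : R -> R) (a b : R) :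
  a <= b -> (forall x, a <= x <= b -> is_derive f x (df x)) ->
  (forall x, a <= x <= b -> df x <= 0) -> f b <= f a.
Proof.
intros Hab Hd Hs.
destruct (MVT_gen f a b df) as [c [Hc He]].
- intros x Hx. apply Hd. rewrite Rmin_left, Rmax_right in Hx by lra. lra.
- intros x Hx. rewrite Rmin_left, Rmax_right in Hx by lra.
  apply derivable_continuous_pt. exists (df x). apply is_derive_Reals, Hd; lra.
- rewrite Rmin_left, Rmax_right in Hc by lra.
  generalize (Hs c Hc); nra.
Qed.

(* Integration by parts makes [A - cos (N x) / (N sin (x/2))], with [A] the
   tail and [N = k + 1/2], have a derivative bounded by that of
   [- 1 / (N sin (x/2))]; both signs of this comparison integrate to the claim. *)
Lemma dirichlet_tail_far (k : nat) (x : R) :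
  0 < x <= PI ->
  Rabs (dirichlet_tail k x) <= 2 / ((INR k + / 2) * sin (x / 2)).
Proof.
intros Hx. set (N := INR k + / 2).
assert (HN : 0 < N) by (unfold N; generalize (pos_INR k); lra).
assert (Hs : forall y, x <= y <= PI -> 0 < sin (y / 2))
  by (intros y Hy; apply sin_gt_0; lra).
assert (Hc : forall y, x <= y <= PI -> 0 <= cos (y / 2))
  by (intros y Hy; apply cos_ge_0; lra).
assert (Hcmp : forall s, s = 1 \/ s = -1 ->
  s * dirichlet_tail k PI + (1 - s * cos (N * PI)) / (N * sin (PI / 2)) <=
  s * dirichlet_tail k x + (1 - s * cos (N * x)) / (N * sin (x / 2))).
{ intros s Hs1.
  (* In the derivative, s D_k cancels against s sin (N y) / sin (y/2) by the closed form. What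
     remains is nonpositive because |cos (N y)| <= 1 and cos (y/2) >= 0 up to PI. *)
  apply (nonincreasing_of_derive
    (fun y => s * dirichlet_tail k y + (1 - s * cos (N * y)) / (N * sin (y / 2)))
    (fun y => - ((1 - s * cos (N * y)) * (cos (y / 2) / (2 * N * (sin (y / 2)) ^ 2)))));
    [lra | |].
  - intros y Hy. generalize (Hs y Hy); intros Hsy.
    replace (- ((1 - s * cos (N * y)) * (cos (y / 2) / (2 * N * (sin (y / 2)) ^ 2))))
      with (plus (s * (- dirichlet k y))
        (s * (sin (N * y) / sin (y / 2))
         - (1 - s * cos (N * y)) * (cos (y / 2) / (2 * N * (sin (y / 2)) ^ 2)))).
    + apply (is_derive_plus (fun y => s * dirichlet_tail k y)
        (fun y => (1 - s * cos (N * y)) / (N * sin (y / 2)))).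
      * apply (is_derive_scal (dirichlet_tail k) y s), is_derive_dirichlet_tail.
      * auto_derive; [apply Rgt_not_eq, Rmult_lt_0_compat; lra|].
        change (y * / 2) with (y / 2). field; lra.
    + unfold plus; simpl.
      replace (sin (N * y)) with (sin (y / 2) * dirichlet k y) by apply dirichlet_closed_form.
      field. lra.
  - intros y Hy.
    assert (H : 0 <= cos (y / 2) / (2 * N * (sin (y / 2)) ^ 2)).
    { apply Rmult_le_pos; [now apply Hc|]. apply Rlt_le, Rinv_0_lt_compat.
      generalize (Hs y Hy); intros. apply Rmult_lt_0_compat; [lra|]. apply pow_lt; lra. }
    assert (H' : 0 <= 1 - s * cos (N * y))
      by (generalize (COS_bound (N * y)); destruct Hs1; subst; lra).
    generalize (Rmult_le_pos _ _ H' H); lra. }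
assert (Hp : 0 < / (N * sin (x / 2)))
  by (apply Rinv_0_lt_compat, Rmult_lt_0_compat; [lra | apply Hs; lra]).
assert (Hq : 0 < / (N * sin (PI / 2)))
  by (apply Rinv_0_lt_compat, Rmult_lt_0_compat; [lra | apply Hs; lra]).
(* The tail vanishes at PI, so the left sides are nonnegative; with 1 - s cos (N x) <= 2 this gives
   s A_k(x) >= -2 / (N sin (x/2)) for both signs. *)
generalize (Hcmp 1 (or_introl eq_refl)) (Hcmp (-1) (or_intror eq_refl)).
rewrite dirichlet_tail_PI. clear Hcmp.
set (d := N * sin (x / 2)) in *. set (d' := N * sin (PI / 2)) in *.
generalize (COS_bound (N * x)) (COS_bound (N * PI)).
unfold Rdiv. intros Hcx Hcp H1 H2.
apply Rabs_le. split; nra.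
Qed.

(** With N = k + 1/2, split at N x = 1. Below, the estimate near 0 gives at most 2 N x + PI <= 6.
    Above, sin (x/2) >= x/6 gives N sin (x/2) > 1/6, and the far estimate gives 12. *)
Lemma dirichlet_tail_bound (k : nat) (x : R) :
  0 <= x <= PI -> Rabs (dirichlet_tail k x) <= 12.
Proof.
intros Hx. set (N := INR k + / 2).
assert (HN : 0 < N) by (unfold N; generalize (pos_INR k); lra).
destruct (Rle_lt_dec (N * x) 1) as [H|H].
- replace (dirichlet_tail k x) with ((dirichlet_tail k x - PI) + PI) by ring.
  eapply Rle_trans; [apply Rabs_triang|].
  generalize (dirichlet_tail_near_0 k x (proj1 Hx)) PI_4 PI_RGT_0; intros.
  rewrite (Rabs_pos_eq PI) by lra. unfold N in H. nra.
- assert (0 < x) by nra.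
  eapply Rle_trans; [apply dirichlet_tail_far; lra|]. fold N.
  assert (Hs : x / 6 <= sin (x / 2)).
  { replace (x / 6) with (x / 2 / 3) by field. apply sin_ge_third; lra. }
  assert (HNs : 1 / 6 < N * sin (x / 2)) by nra.
  apply Rmult_le_reg_r with (N * sin (x / 2)); [lra|].
  unfold Rdiv. rewrite Rmult_assoc, Rinv_l by lra. lra.
Qed.

(** * Integrals of the two real kernels over d <= y <= 2 PI - d *)

Lemma is_RInt_sin_kernel (k : nat) (d : R) :
  0 < d <= PI ->
  is_RInt (fun y => sin ((INR k + / 2) * y) / (2 * sin (y / 2))) d (2 * PI - d)
    (dirichlet_tail k d).
Proof.
intros Hd.
apply is_RInt_ext with (fun y => / 2 * dirichlet k y).
- intros y Hy. rewrite Rmin_left, Rmax_right in Hy by lra.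
  assert (0 < sin (y / 2)) by (apply sin_gt_0; lra).
  rewrite <- dirichlet_closed_form.
  change (/ 2 * dirichlet k y = sin (y / 2) * dirichlet k y / (2 * sin (y / 2))).
  field; lra.
(* The integrand is D_k/2, and the antisymmetry of the tail about PI makes the two endpoint
   contributions equal. *)
- replace (dirichlet_tail k d)
    with ((- / 2) * dirichlet_tail k (2 * PI - d) - (- / 2) * dirichlet_tail k d)
    by (rewrite dirichlet_tail_reflect; field).
  refine (is_RInt_derive (V := R_CompleteNormedModule)
    (fun y => (- / 2) * dirichlet_tail k y) _ _ _ _ _).
  + intros y _. replace (/ 2 * dirichlet k y) with ((- / 2) * (- dirichlet k y)) by ring.
    apply (is_derive_scal (dirichlet_tail k)), is_derive_dirichlet_tail.
  + intros y _. apply (continuous_scal_r (V := R_NormedModule) (/ 2) (dirichlet k)).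
    apply continuous_dirichlet.
Qed.

(* The integrand is odd with respect to the midpoint [PI]. *)
Lemma is_RInt_cos_kernel (k : nat) (d : R) :
  0 < d <= PI ->
  is_RInt (fun y => cos ((INR k + / 2) * y) / (2 * sin (y / 2))) d (2 * PI - d) 0.
Proof.
intros Hd. set (f := fun y => cos ((INR k + / 2) * y) / (2 * sin (y / 2))).
assert (Hex : ex_RInt f d (2 * PI - d)).
{ apply (ex_RInt_continuous (V := R_CompleteNormedModule)). intros y Hy.
  rewrite Rmin_left, Rmax_right in Hy by lra.
  apply (ex_derive_continuous f). unfold f. auto_derive.
  assert (0 < sin (y / 2)) by (apply sin_gt_0; lra).
  unfold Rdiv in *. repeat split; lra. }
destruct Hex as [l Hl].
assert (Hl' : is_RInt f d (2 * PI - d) (opp l)).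
{ apply is_RInt_ext with (fun y => scal (-1) (f (-1 * y + 2 * PI))).
  - intros y _. unfold f, scal; simpl; unfold mult; simpl.
    (* The half-integer frequency leaves an extra PI, hence a change of sign of the cosine, while
       sin (y/2) is unchanged by y -> 2 PI - y. *)
    replace ((INR k + / 2) * (-1 * y + 2 * PI))
      with (- ((INR k + / 2) * y) + PI + 2 * INR k * PI) by field.
    rewrite cos_period, neg_cos, cos_neg.
    replace ((-1 * y + 2 * PI) / 2) with (PI - y / 2) by field.
    rewrite sin_PI_x. unfold Rdiv; ring.
  - apply (is_RInt_comp_lin f (-1) (2 * PI)).
    replace (-1 * d + 2 * PI) with (2 * PI - d) by ring.
    replace (-1 * (2 * PI - d) + 2 * PI) with d by ring.
    now apply is_RInt_swap. }
assert (E : l = - l).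
{ transitivity (RInt f d (2 * PI - d)); [symmetry|]; now apply is_RInt_unique. }
replace 0 with l by lra. exact Hl.
Qed.

(** * General rules for vector-valued Riemann integrals *)

Lemma is_RInt_Cmult (w : C) (f : R -> C) (a b : R) (l : C) :
  is_RInt (V := C_R_NormedModule) f a b l ->
  is_RInt (V := C_R_NormedModule) (fun x => (w * f x)%C) a b (w * l)%C.
Proof.
intros Hf.
(* [C_R_NormedModule] has real scalars only, so a complex factor is treated coordinate by
   coordinate. *)
assert (H1 := is_RInt_fct_extend_fst (U := R_NormedModule) (V := R_NormedModule) f a b l Hf).
assert (H2 := is_RInt_fct_extend_snd (U := R_NormedModule) (V := R_NormedModule) f a b l Hf).
apply (is_RInt_fct_extend_pair (U := R_NormedModule) (V := R_NormedModule)); simpl.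
- apply (is_RInt_minus (V := R_NormedModule)
    (fun x => fst w * fst (f x)) (fun x => snd w * snd (f x)));
    now apply (is_RInt_scal (V := R_NormedModule)).
- apply (is_RInt_plus (V := R_NormedModule)
    (fun x => fst w * snd (f x)) (fun x => snd w * fst (f x)));
    now apply (is_RInt_scal (V := R_NormedModule)).
Qed.

Lemma is_RInt_sum_n {V : NormedModule R_AbsRing} (f : nat -> R -> V) (a b : R)
  (l : nat -> V) (n : nat) :
  (forall k, is_RInt (f k) a b (l k)) ->
  is_RInt (fun x => sum_n (fun k => f k x) n) a b (sum_n l n).
Proof.
intros H. induction n as [|n IH].
- rewrite sum_O. apply is_RInt_ext with (f 0%nat); [|apply H].
  intros x _. now rewrite sum_O.
- rewrite sum_Sn.
  apply is_RInt_ext with (fun x => plus (sum_n (fun k => f k x) n) (f (S n) x)).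
  + intros x _. now rewrite sum_Sn.
  + apply (is_RInt_plus (V := V)); [exact IH | apply H].
Qed.

Lemma is_RInt_zero_fun {V : NormedModule R_AbsRing} (f : R -> V) (a b : R) :
  (forall x, Rmin a b < x < Rmax a b -> f x = zero) -> is_RInt f a b zero.
Proof.
intros H. apply is_RInt_ext with (fun _ => zero).
- intros x Hx. symmetry; now apply H.
- exact (eq_ind _ (is_RInt _ a b) (is_RInt_const a b zero) _ (scal_zero_r (V := V) (b - a))).
Qed.

Lemma is_RInt_translate {V : NormedModule R_AbsRing} (f : R -> V) (s a b : R) (l : V) :
  is_RInt f (a + s) (b + s) l -> is_RInt (fun y => f (y + s)) a b l.
Proof.
intros H.
apply is_RInt_ext with (fun y => scal 1 (f (1 * y + s))).
- intros y _. rewrite Rmult_1_l. apply (scal_one (V := V)).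
- apply is_RInt_comp_lin. now rewrite !Rmult_1_l.
Qed.

(** Cut [t, p + t] at p and shift the piece beyond p back to [0, t]. This allows a rotation of the
    circle that puts the singular point at both ends of the period. *)
Lemma is_RInt_periodic {V : CompleteNormedModule R_AbsRing} (f : R -> V) (p t : R) (l : V) :
  0 <= t <= p -> (forall x, f (x + p) = f x) ->
  is_RInt (fun y => f (y + t)) 0 p l -> is_RInt f 0 p l.
Proof.
intros Ht Hp H.
assert (H' : is_RInt f t (p + t) l).
{ apply is_RInt_ext with (fun x => f (x + - t + t)).
  - intros x _. f_equal. ring.
  - apply (is_RInt_translate (fun y => f (y + t))).
    replace (t + - t) with 0 by ring. now replace (p + t + - t) with p by ring. }
assert (Hex : ex_RInt f t (p + t)) by now exists l.
destruct (ex_RInt_Chasles_1 f t p (p + t)) as [l1 H1]; [lra | exact Hex |].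
destruct (ex_RInt_Chasles_2 f t p (p + t)) as [l2 H2]; [lra | exact Hex |].
assert (H2' : is_RInt f 0 t l2).
{ apply is_RInt_ext with (fun x => f (x + p)); [intros; apply Hp|].
  apply is_RInt_translate. rewrite Rplus_0_l. now rewrite Rplus_comm with (r1 := t). }
replace l with (plus l2 l1); [now apply is_RInt_Chasles with t|].
rewrite plus_comm. transitivity (RInt f t (p + t)); [symmetry|].
- apply is_RInt_unique. now apply is_RInt_Chasles with p.
- now apply is_RInt_unique.
Qed.

(** * Parametrisation of the circle, the Cauchy kernel, chords and arcs *)

Lemma Cexpi_plus (x y : R) : Cexpi (x + y) = (Cexpi x * Cexpi y)%C.
Proof.
unfold Cexpi, Cmult; simpl. rewrite cos_plus, sin_plus.
f_equal; ring.
Qed.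

Lemma Cexpi_0 : Cexpi 0 = RtoC 1.
Proof. unfold Cexpi. now rewrite cos_0, sin_0. Qed.

Lemma Cexpi_period (x : R) : Cexpi (x + 2 * PI) = Cexpi x.
Proof.
unfold Cexpi. rewrite cos_plus, sin_plus, cos_2PI, sin_2PI.
f_equal; ring.
Qed.

Lemma Cexpi_pow (x : R) (k : nat) : (Cexpi x ^ k)%C = Cexpi (INR k * x).
Proof.
induction k as [|k IH].
- simpl. now rewrite Rmult_0_l, Cexpi_0.
- rewrite Cpow_S, IH, S_INR, <- Cexpi_plus. f_equal. ring.
Qed.

Lemma Cmod_Cexpi (x : R) : Cmod (Cexpi x) = 1.
Proof.
unfold Cmod, Cexpi; simpl fst; simpl snd.
replace (cos x ^ 2 + sin x ^ 2) with 1; [apply sqrt_1|].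
generalize (sin2_cos2 x); unfold Rsqr; lra.
Qed.

Lemma Cexpi_neq_0 (x : R) : Cexpi x <> 0%C.
Proof. apply Cmod_gt_0. rewrite Cmod_Cexpi. lra. Qed.

Lemma Cexpi_opp (x : R) : Cexpi (- x) = (/ Cexpi x)%C.
Proof.
generalize (Cexpi_neq_0 x); intros H.
replace (Cexpi (- x)) with (Cexpi (- x) * Cexpi x * / Cexpi x)%C by (field; exact H).
rewrite <- Cexpi_plus, Rplus_opp_l, Cexpi_0. apply Cmult_1_l.
Qed.

Lemma Cexpi_surj (z : C) : unit_circle z -> exists t, 0 <= t <= 2 * PI /\ z = Cexpi t.
Proof.
unfold unit_circle. intros Hz. destruct z as [a b]. 
assert (H : a ^ 2 + b ^ 2 = 1).
{ unfold Cmod in Hz; simpl fst in Hz; simpl snd in Hz.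
  rewrite <- (sqrt_sqrt (a ^ 2 + b ^ 2)) by nra. rewrite Hz. ring. }
assert (Ha : -1 <= a <= 1) by nra.
generalize (acos_bound a) PI_RGT_0; intros Hb HP.
assert (Hs : sin (acos a) = Rabs b).
{ rewrite sin_acos by exact Ha. rewrite <- sqrt_Rsqr_abs. f_equal. unfold Rsqr. lra. }
destruct (Rle_lt_dec 0 b).
- exists (acos a). split; [lra|]. unfold Cexpi. rewrite Hs, cos_acos, Rabs_pos_eq; easy.
- exists (- acos a + 2 * PI). split; [lra|]. rewrite Cexpi_period. unfold Cexpi.
  rewrite cos_neg, sin_neg, Hs, cos_acos by exact Ha. rewrite Rabs_left by lra.
  f_equal; ring.
Qed.

(** Source of both the chord length 2 sin (y/2) and the half-integer frequencies of the kernels. *)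
Lemma Cexpi_minus_1 (y : R) :
  (Cexpi y - 1)%C = (RtoC (2 * sin (y / 2)) * Ci * Cexpi (y / 2))%C.
Proof.
replace y with (y / 2 + y / 2) at 1 by field.
rewrite Cexpi_plus. unfold Cexpi, Cmult, Cminus, Cplus, Copp, RtoC, Ci; simpl.
generalize (sin2_cos2 (y / 2)); unfold Rsqr; intros H.
f_equal; nra.
Qed.

(** Dividing by the factored e^(iy) - 1 cancels [Ci] and leaves one factor e^(iy/2). A real [m]
    covers both k and -(k+1), whose shifts by 1/2 are opposite. *)
Lemma cauchy_kernel (m y : R) :
  sin (y / 2) <> 0 ->
  (Cexpi (m * y) / (Cexpi y - 1) * (Ci * Cexpi y))%C =
  (cos ((m + / 2) * y) / (2 * sin (y / 2)), sin ((m + / 2) * y) / (2 * sin (y / 2))).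
Proof.
intros Hs.
assert (Hci : Ci <> 0%C) by (apply Cmod_gt_0; rewrite Cmod_Ci; lra).
assert (Hr : RtoC (2 * sin (y / 2)) <> 0%C)
  by (intros E; apply RtoC_inj in E; lra).
transitivity (RtoC (/ (2 * sin (y / 2))) * Cexpi ((m + / 2) * y))%C.
- rewrite Cexpi_minus_1.
  replace ((m + / 2) * y) with (m * y + y / 2) by field.
  replace (Cexpi y) with (Cexpi (y / 2) * Cexpi (y / 2))%C
    by (rewrite <- Cexpi_plus; f_equal; field).
  rewrite Cexpi_plus, RtoC_inv by lra.
  field. repeat split; auto. apply Cexpi_neq_0.
- unfold Cexpi, Cmult, RtoC; simpl. f_equal; field; exact Hs.
Qed.

Lemma Cmod_chord (z : C) (y : R) :
  unit_circle z -> 0 <= y <= 2 * PI -> Cmod (z * Cexpi y - z)%C = 2 * sin (y / 2).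
Proof.
unfold unit_circle. intros Hz Hy.
replace (z * Cexpi y - z)%C with (z * (Cexpi y - 1))%C by ring.
rewrite Cexpi_minus_1, !Cmod_mult, Hz, Cmod_Ci, Cmod_Cexpi, Cmod_R.
assert (0 <= sin (y / 2)) by (apply sin_ge_0; lra).
rewrite Rabs_pos_eq; lra.
Qed.

Lemma Cpowz_of_nat (z : C) (k : nat) : Cpowz z (Z.of_nat k) = (z ^ k)%C.
Proof.
destruct k as [|k]; [reflexivity|].
simpl Z.of_nat. unfold Cpowz. now rewrite SuccNat2Pos.id_succ.
Qed.

Lemma Cpowz_opp_of_nat (z : C) (k : nat) :
  Cpowz z (- Z.of_nat (S k)) = (/ z ^ S k)%C.
Proof. simpl Z.of_nat. unfold Cpowz; simpl. now rewrite SuccNat2Pos.id_succ. Qed.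

Lemma Cmod_Cpowz (z : C) (n : Z) : unit_circle z -> Cmod (Cpowz z n) = 1.
Proof.
unfold unit_circle. intros Hz. 
assert (Hp : forall k, Cmod (z ^ k)%C = 1) by (intros k; now rewrite Cmod_pow, Hz, pow1).
destruct n as [|p|p]; simpl.
- apply Cmod_1.
- apply Hp.
- rewrite Cmod_inv, Hp; [apply Rinv_1|]. apply Cmod_gt_0. rewrite Hp. lra.
Qed.

(* Half-width of the arc removed by the condition |zeta - z| >= eps. For
   [eps > 2] it is [PI], since [asin] is constant beyond [1]. *)
Definition arc_halfwidth (eps : R) : R := 2 * asin (eps / 2).

Lemma arc_halfwidth_big (eps : R) : 2 <= eps -> arc_halfwidth eps = PI.
Proof.
intros H. unfold arc_halfwidth, asin.
destruct (Rle_dec (eps / 2) (-1)); [lra|].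
destruct (Rle_dec 1 (eps / 2)); [field | lra].
Qed.

Lemma arc_halfwidth_range (eps : R) : 0 < eps -> 0 < arc_halfwidth eps <= PI.
Proof.
intros H. generalize PI_RGT_0; intros HP.
destruct (Rle_lt_dec 2 eps) as [H2|H2]; [rewrite arc_halfwidth_big by lra; lra|].
unfold arc_halfwidth. generalize (asin_bound (eps / 2)); intros Hb.
split; [|lra].
destruct (Rlt_le_dec 0 (asin (eps / 2))) as [|Hn]; [lra|].
assert (E := sin_asin (eps / 2)). 
assert (0 <= sin (- asin (eps / 2))) by (apply sin_ge_0; lra).
rewrite sin_neg in *. lra.
Qed.

(** With a = asin (eps/2), a/3 <= sin a = eps/2. *)
Lemma arc_halfwidth_le (eps : R) : 0 < eps < 2 -> arc_halfwidth eps <= 3 * eps.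
Proof.
intros H. generalize (arc_halfwidth_range eps (proj1 H)).
unfold arc_halfwidth. intros Hr.
generalize (sin_ge_third (asin (eps / 2))) (sin_asin (eps / 2)). lra.
Qed.

(** Together with [chord_ge], this turns the truncation condition into an interval of angles, up to
    two endpoints that do not affect the integral. Past PI, the angle y/2 is reflected to PI - y/2,
    where the sine is increasing. *)
Lemma chord_lt (eps y : R) :
  0 < eps -> 0 < y < 2 * PI ->
  y < arc_halfwidth eps \/ 2 * PI - arc_halfwidth eps < y -> 2 * sin (y / 2) < eps.
Proof.
intros He Hy H. destruct (Rlt_le_dec 2 eps) as [H2|H2].
- generalize (SIN_bound (y / 2)); lra.
- generalize (arc_halfwidth_range eps He); unfold arc_halfwidth in *; intros Hr.
  assert (E := sin_asin (eps / 2)).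
  destruct H as [H|H].
  + assert (sin (y / 2) < sin (asin (eps / 2))) by (apply sin_increasing_1; lra). lra.
  + rewrite <- (sin_PI_x (y / 2)).
    assert (sin (PI - y / 2) < sin (asin (eps / 2))) by (apply sin_increasing_1; lra). lra.
Qed.

Lemma chord_ge (eps y : R) :
  0 < eps -> arc_halfwidth eps < y < 2 * PI - arc_halfwidth eps ->
  eps <= 2 * sin (y / 2).
Proof.
intros He H. destruct (Rle_lt_dec 2 eps) as [H2|H2].
- rewrite arc_halfwidth_big in H by exact H2. lra.
- generalize (arc_halfwidth_range eps He); unfold arc_halfwidth in *; intros Hr.
  assert (E := sin_asin (eps / 2)).
  destruct (Rle_lt_dec y PI).
  + assert (sin (asin (eps / 2)) <= sin (y / 2)) by (apply sin_incr_1; lra). lra.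
  + rewrite <- (sin_PI_x (y / 2)).
    assert (sin (asin (eps / 2)) <= sin (PI - y / 2)) by (apply sin_incr_1; lra). lra.
Qed.

(** * Uniform convergence of series and limits in the truncation parameter *)

Ltac C_ring := match goal with |- @eq _ ?x ?y => change (@eq C x y); ring end.

Lemma Cmod_sum_n_tail (a : nat -> C) (m : nat -> R) (M j : nat) :
  (forall k, Cmod (a k) <= m k) ->
  Cmod (sum_n (G := C_AbelianMonoid) a (M + j) - sum_n (G := C_AbelianMonoid) a M)%C
  <= sum_n m (M + j) - sum_n m M.
Proof.
intros H. induction j as [|j IH].
- rewrite Nat.add_0_r. unfold Cminus. rewrite Cplus_opp_r, Cmod_0. lra.
- rewrite Nat.add_succ_r, !sum_Sn.
  change (Cmod (sum_n (G := C_AbelianMonoid) a (M + j) + a (S (M + j))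
      - sum_n (G := C_AbelianMonoid) a M)%C
    <= sum_n m (M + j) + m (S (M + j)) - sum_n m M).
  replace (sum_n (G := C_AbelianMonoid) a (M + j) + a (S (M + j))
      - sum_n (G := C_AbelianMonoid) a M)%C
    with ((sum_n (G := C_AbelianMonoid) a (M + j) - sum_n (G := C_AbelianMonoid) a M)
      + a (S (M + j)))%C by ring.
  eapply Rle_trans; [apply Cmod_triangle|]. generalize (H (S (M + j))); lra.
Qed.

(** Limit of the finite estimate. The bound involves only the majorant, which is what makes the
    convergence uniform in a parameter. *)
Lemma Cmod_series_tail (a : nat -> C) (l : C) (m : nat -> R) (lm : R) (M : nat) :
  (forall k, Cmod (a k) <= m k) ->
  is_series (V := C_NormedModule) a l -> is_series m lm ->
  Cmod (l - sum_n (G := C_AbelianMonoid) a M)%C <= lm - sum_n m M.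
Proof.
intros H Ha Hm.
apply (filterlim_le (F := eventually)
  (fun n => Cmod (sum_n (G := C_AbelianMonoid) a n - sum_n (G := C_AbelianMonoid) a M)%C)
  (fun n => sum_n m n - sum_n m M)
  (Cmod (l - sum_n (G := C_AbelianMonoid) a M)%C) (lm - sum_n m M)).
- exists M. intros n Hn. replace n with (M + (n - M))%nat by lia.
  now apply Cmod_sum_n_tail.
- apply (filterlim_comp _ _ _
    (fun n => (sum_n (G := C_AbelianMonoid) a n - sum_n (G := C_AbelianMonoid) a M)%C) Cmod
    eventually (locally (l - sum_n (G := C_AbelianMonoid) a M : C_NormedModule)%C)).
  + apply (filterlim_comp_2 (G := locally (l : C_NormedModule))
      (H := locally (- sum_n (G := C_AbelianMonoid) a M : C_NormedModule)%C)
      (sum_n (G := C_AbelianMonoid) a)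
      (fun _ => (- sum_n (G := C_AbelianMonoid) a M)%C) Cplus).
    * exact Ha.
    * apply filterlim_const.
    * apply (filterlim_plus (V := C_NormedModule)).
  + apply (filterlim_norm (V := C_NormedModule)).
- apply (filterlim_comp_2 (G := locally lm) (H := locally (- sum_n m M))
    (sum_n m) (fun _ => - sum_n m M) Rplus).
  + exact Hm.
  + apply filterlim_const.
  + apply (filterlim_plus (V := R_NormedModule)).
Qed.

(** Neighbourhoods in [fct_UniformSpace] are those of uniform convergence. [T] is arbitrary because
    the test is applied both to angles and to positive truncation parameters. *)
Lemma weierstrass_M_test {T : Type} (f : nat -> T -> C) (g : T -> C) (m : nat -> R) :
  (forall k t, Cmod (f k t) <= m k) -> ex_series m ->
  (forall t, is_series (V := C_NormedModule) (fun k => f k t) (g t)) ->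
  filterlim (fun M t => sum_n (G := C_AbelianMonoid) (fun k => f k t) M) eventually
    (locally (g : fct_UniformSpace T C_UniformSpace)).
Proof.
intros H [lm Hm] Hs.
apply (filterlim_locally (U := fct_UniformSpace T C_UniformSpace)). intros eps.
assert (He := proj1 (filterlim_locally (F := eventually) (sum_n m) lm) Hm eps).
apply filter_imp with (2 := He). intros M HM t.
apply ball_sym in HM. 
apply (ball_sym (M := C_UniformSpace)).
(* Balls of [C_UniformSpace] are products of intervals; a small modulus suffices to lie in one. *)
apply (C_NormedModule_mixin_compat1 _ (g t) eps).
change (Cmod (g t - sum_n (G := C_AbelianMonoid) (fun k => f k t) M)%C < eps).
eapply Rle_lt_trans; [apply (Cmod_series_tail _ _ m lm M (fun k => H k t) (Hs t) Hm)|].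
generalize (Rle_abs (lm - sum_n m M)).
change (Rabs (lm - sum_n m M) < eps) in HM. lra.
Qed.

(** The error is at most (2k+1) times the half-width, hence at most K eps with K = 3 (2k+1). This
    rate depends on k, so the exchange with the series needs the uniform bound as well. *)
Lemma dirichlet_tail_arc_lim (k : nat) :
  filterlim (fun eps => dirichlet_tail k (arc_halfwidth eps)) (at_right 0) (locally PI).
Proof.
apply (filterlim_locally (U := R_UniformSpace)). intros e.
set (K := (2 * INR k + 1) * 3).
assert (HK : 3 <= K) by (unfold K; generalize (pos_INR k); lra).
assert (Hd : 0 < Rmin 2 (e / K))
  by (apply Rmin_glb_lt; [lra | apply Rdiv_lt_0_compat; [apply cond_pos | lra]]).
exists (mkposreal _ Hd). intros eps Hb Hpos.
change (Rabs (eps - 0) < Rmin 2 (e / K)) in Hb.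
rewrite Rminus_0_r, Rabs_pos_eq in Hb by lra.
generalize (Rmin_l 2 (e / K)) (Rmin_r 2 (e / K)); intros Hl Hr.
change (Rabs (dirichlet_tail k (arc_halfwidth eps) - PI) < e).
generalize (arc_halfwidth_range eps Hpos) (arc_halfwidth_le eps); intros Ha1 Ha2.
eapply Rle_lt_trans; [apply dirichlet_tail_near_0; lra|].
apply Rle_lt_trans with (K * eps).
- unfold K. rewrite Rmult_assoc.
  apply Rmult_le_compat_l; [generalize (pos_INR k) |]; lra.
- replace (pos e) with (K * (e / K)) by (field; lra).
  apply Rmult_lt_compat_l; lra.
Qed.

Lemma filterlim_sum_n {T : Type} {F : (T -> Prop) -> Prop} {FF : Filter F}
  (f : nat -> T -> C) (l : nat -> C) (n : nat) :
  (forall k, filterlim (f k) F (locally (l k : C_UniformSpace))) ->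
  filterlim (fun t => sum_n (G := C_AbelianMonoid) (fun k => f k t) n) F
    (locally (sum_n (G := C_AbelianMonoid) l n : C_UniformSpace)).
Proof.
intros H. induction n as [|n IH].
- rewrite sum_O. apply filterlim_ext with (f 0%nat); [|apply H].
  intros t. now rewrite sum_O.
- rewrite sum_Sn.
  apply filterlim_ext with
    (fun t => (sum_n (G := C_AbelianMonoid) (fun k => f k t) n + f (S n) t)%C).
  { intros t. now rewrite sum_Sn. }
  apply (filterlim_comp_2
    (G := locally (sum_n (G := C_AbelianMonoid) l n : C_NormedModule))
    (H := locally (l (S n) : C_NormedModule))
    (fun t => sum_n (G := C_AbelianMonoid) (fun k => f k t) n) (f (S n)) Cplus).
  + exact IH.
  + apply H.
  + apply (filterlim_plus (V := C_NormedModule)).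
Qed.

(** * Truncated integrals of a Laurent series, term by term *)

Definition truncated_integrand (f : C -> C) (z : C) (eps x : R) : C :=
  let zeta := Cexpi x in
  if Rle_dec eps (Cmod (zeta - z)%C) then (f zeta * (Ci * zeta))%C else RtoC 0.

(* The terms of index [k] and [-(k+1)] of a Laurent series: their truncated
   integrals involve the same Dirichlet kernel, with opposite signs. *)
Definition laurent_pair (c : Z -> C) (k : nat) (zeta : C) : C :=
  (c (Z.of_nat k) * Cpowz zeta (Z.of_nat k)
   + c (- Z.of_nat (S k))%Z * Cpowz zeta (- Z.of_nat (S k)))%C.

(** The same pair weighted by [eta]; the sign comes from the opposite imaginary parts of the two
    kernels. *)
Definition laurent_odd_pair (c : Z -> C) (k : nat) (zeta : C) : C :=
  (c (Z.of_nat k) * Cpowz zeta (Z.of_nat k)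
   - c (- Z.of_nat (S k))%Z * Cpowz zeta (- Z.of_nat (S k)))%C.

Definition laurent_pair_bound (c : Z -> C) (k : nat) : R :=
  Cmod (c (Z.of_nat k)) + Cmod (c (- Z.of_nat (S k))%Z).

Lemma Cmod_laurent_pair (c : Z -> C) (k : nat) (zeta : C) :
  unit_circle zeta -> Cmod (laurent_pair c k zeta) <= laurent_pair_bound c k.
Proof.
intros H. eapply Rle_trans; [apply Cmod_triangle|].
rewrite !Cmod_mult, !Cmod_Cpowz by exact H. unfold laurent_pair_bound. lra.
Qed.

Lemma Cmod_laurent_odd_pair (c : Z -> C) (k : nat) (zeta : C) :
  unit_circle zeta -> Cmod (laurent_odd_pair c k zeta) <= laurent_pair_bound c k.
Proof.
intros H. eapply Rle_trans; [apply Cmod_triangle|].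
rewrite Cmod_opp, !Cmod_mult, !Cmod_Cpowz by exact H. unfold laurent_pair_bound. lra.
Qed.

Lemma ex_series_laurent_pair_bound (c : Z -> C) :
  abs_summable c -> ex_series (laurent_pair_bound c).
Proof.
intros [l [lp [ln [Hp [Hn _]]]]]. exists (plus lp ln).
now apply (is_series_plus (V := R_NormedModule)).
Qed.

(** One factor z cancels between d zeta and zeta - z. The two kernels are then C0 + i S0 and C0 - i
    S0, so the sum of the terms multiplies C0 and their difference multiplies i S0. *)
Lemma laurent_pair_kernel (c : Z -> C) (t y : R) (k : nat) :
  sin (y / 2) <> 0 ->
  let z := Cexpi t in
  let C0 := cos ((INR k + / 2) * y) / (2 * sin (y / 2)) in
  let S0 := sin ((INR k + / 2) * y) / (2 * sin (y / 2)) in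
  (laurent_pair c k (z * Cexpi y) / (z * Cexpi y - z) * (Ci * (z * Cexpi y)))%C =
  (laurent_pair c k z * RtoC C0 + laurent_odd_pair c k z * Ci * RtoC S0)%C.
Proof.
intros Hs z C0 S0.
assert (Hz : z <> 0%C) by apply Cexpi_neq_0.
assert (Hy : (Cexpi y - 1)%C <> 0%C).
{ apply Cmod_gt_0. rewrite Cexpi_minus_1, !Cmod_mult, Cmod_Ci, Cmod_Cexpi, Cmod_R.
  assert (0 < Rabs (2 * sin (y / 2))) by (apply Rabs_pos_lt; lra). lra. }
assert (Hp : (Cexpi (INR k * y) / (Cexpi y - 1) * (Ci * Cexpi y))%C
   = (RtoC C0 + Ci * RtoC S0)%C).
{ rewrite cauchy_kernel by exact Hs. fold C0 S0.
  unfold Cplus, Cmult, RtoC, Ci; simpl. f_equal; ring. }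
assert (Hn : (Cexpi (- INR (S k) * y) / (Cexpi y - 1) * (Ci * Cexpi y))%C
   = (RtoC C0 - Ci * RtoC S0)%C).
{ rewrite cauchy_kernel by exact Hs.
  replace ((- INR (S k) + / 2) * y) with (- ((INR k + / 2) * y))
    by (rewrite S_INR; field).
  rewrite cos_neg, sin_neg.
  replace (- sin ((INR k + / 2) * y) / (2 * sin (y / 2))) with (- S0)
    by (unfold S0, Rdiv; ring).
  fold C0.
  unfold Cminus, Copp, Cplus, Cmult, RtoC, Ci; simpl. f_equal; ring. }
unfold laurent_pair, laurent_odd_pair.
rewrite !Cpowz_of_nat, !Cpowz_opp_of_nat, !Cpow_mult_l.
rewrite (Cexpi_pow y k), (Cexpi_pow y (S k)).
assert (Hzk : (z ^ S k)%C <> 0%C) by now apply Cpow_nz.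
assert (HEk : Cexpi (INR (S k) * y) <> 0%C) by apply Cexpi_neq_0.
replace (- INR (S k) * y) with (- (INR (S k) * y)) in Hn by ring.
rewrite Cexpi_opp in Hn.
transitivity
  (c (Z.of_nat k) * z ^ k * (Cexpi (INR k * y) / (Cexpi y - 1) * (Ci * Cexpi y))
   + c (- Z.of_nat (S k))%Z * / z ^ S k
     * (/ Cexpi (INR (S k) * y) / (Cexpi y - 1) * (Ci * Cexpi y)))%C.
- replace (z * Cexpi y - z)%C with (z * (Cexpi y - 1))%C by ring.
  revert Hzk HEk Hy.
  generalize (Cexpi (INR (S k) * y)) (z ^ S k)%C.
  intros E Zk HZ HE Hy. field. repeat split; assumption.
- rewrite Hp, Hn. ring.
Qed.

(** After rotation by t the integrand vanishes near both ends of [0, 2 PI], and only [d, 2 PI - d]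
    contributes, with d the half-width. *)
Lemma is_RInt_truncated_pair (c : Z -> C) (t eps : R) (k : nat) :
  0 <= t <= 2 * PI -> 0 < eps ->
  is_RInt (V := C_R_NormedModule)
    (truncated_integrand (fun zeta => laurent_pair c k zeta / (zeta - Cexpi t))%C
       (Cexpi t) eps)
    0 (2 * PI)
    (laurent_odd_pair c k (Cexpi t) * Ci * RtoC (dirichlet_tail k (arc_halfwidth eps)))%C.
Proof.
intros Ht He. set (z := Cexpi t).
set (h := truncated_integrand _ _ _).
assert (Hz : unit_circle z) by apply Cmod_Cexpi.
generalize PI_RGT_0; intros HP.
generalize (arc_halfwidth_range eps He).
generalize (chord_lt eps) (chord_ge eps).
set (d := arc_halfwidth eps). intros Hlt Hge Hd.
apply (is_RInt_periodic (V := C_R_CompleteNormedModule) h (2 * PI) t); [exact Ht | |].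
{ intros x. unfold h, truncated_integrand. now rewrite Cexpi_period. }
assert (Hh : forall y, Cexpi (y + t) = (z * Cexpi y)%C)
  by (intros y; rewrite Rplus_comm; apply Cexpi_plus).
assert (Hout : forall y, 0 < y < 2 * PI -> y < d \/ 2 * PI - d < y ->
  h (y + t) = RtoC 0).
{ intros y Hy Hyd. unfold h, truncated_integrand. rewrite Hh, Cmod_chord by (trivial; lra).
  destruct (Rle_dec eps (2 * sin (y / 2))); [|easy].
  generalize (Hlt y He Hy Hyd); lra. }
assert (Hmid : is_RInt (V := C_R_NormedModule) (fun y => h (y + t)) d (2 * PI - d)
  (laurent_odd_pair c k z * Ci * RtoC (dirichlet_tail k d))%C).
{ apply is_RInt_ext with (fun y =>
    (laurent_pair c k z * RtoC (cos ((INR k + / 2) * y) / (2 * sin (y / 2)))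
     + laurent_odd_pair c k z * Ci * RtoC (sin ((INR k + / 2) * y) / (2 * sin (y / 2))))%C).
  - intros y Hy. rewrite Rmin_left, Rmax_right in Hy by lra.
    unfold h, truncated_integrand. rewrite Hh, Cmod_chord by (trivial; lra).
    destruct (Rle_dec eps (2 * sin (y / 2))) as [_|Hn]; [|now elim Hn; apply Hge].
    symmetry. apply laurent_pair_kernel.
    apply Rgt_not_eq, sin_gt_0; lra.
  (* The zero summand is the integral of the cosine kernel. *)
  - replace (laurent_odd_pair c k z * Ci * RtoC (dirichlet_tail k d))%C
      with (laurent_pair c k z * RtoC 0
        + laurent_odd_pair c k z * Ci * RtoC (dirichlet_tail k d))%C by ring.
    assert (HR : forall (f : R -> R) l, is_RInt f d (2 * PI - d) l ->
      is_RInt (V := C_R_NormedModule) (fun y => RtoC (f y)) d (2 * PI - d) (RtoC l)).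
    { intros f l Hf.
      apply (is_RInt_fct_extend_pair (U := R_NormedModule) (V := R_NormedModule)); simpl;
        [exact Hf | now apply (is_RInt_zero_fun (V := R_NormedModule))]. }
    apply (is_RInt_plus (V := C_R_NormedModule)
      (fun y => laurent_pair c k z * RtoC (cos ((INR k + / 2) * y) / (2 * sin (y / 2))))%C
      (fun y => laurent_odd_pair c k z * Ci
         * RtoC (sin ((INR k + / 2) * y) / (2 * sin (y / 2))))%C);
      apply is_RInt_Cmult; apply HR;
      [now apply is_RInt_cos_kernel | now apply is_RInt_sin_kernel]. }
assert (Hl : is_RInt (V := C_R_NormedModule) (fun y => h (y + t)) 0 d (RtoC 0)).
{ apply (is_RInt_zero_fun (V := C_R_NormedModule)). intros y Hy.
  rewrite Rmin_left, Rmax_right in Hy by lra. apply Hout; lra. }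
assert (Hr : is_RInt (V := C_R_NormedModule) (fun y => h (y + t)) (2 * PI - d) (2 * PI)
  (RtoC 0)).
{ apply (is_RInt_zero_fun (V := C_R_NormedModule)). intros y Hy.
  rewrite Rmin_left, Rmax_right in Hy by lra. apply Hout; lra. }
assert (Hs := is_RInt_Chasles (V := C_R_NormedModule) _ _ _ _ _ _
  (is_RInt_Chasles (V := C_R_NormedModule) _ _ _ _ _ _ Hl Hmid) Hr).
replace (laurent_odd_pair c k z * Ci * RtoC (dirichlet_tail k d))%C
  with (RtoC 0 + laurent_odd_pair c k z * Ci * RtoC (dirichlet_tail k d) + RtoC 0)%C by ring.
exact Hs.
Qed.

Lemma is_series_laurent_pair (c : Z -> C) (zeta l : C) :
  is_Zseries (V := C_NormedModule) (fun n => (c n * Cpowz zeta n)%C) l ->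
  is_series (V := C_NormedModule) (fun k => laurent_pair c k zeta) l.
Proof.
intros [lp [ln [Hp [Hn ->]]]]. exact (is_series_plus _ _ _ _ Hp Hn).
Qed.

(** Uniform convergence on the truncated circle gives both the integrability of the limit and the
    exchange of sum and integral. *)
Lemma truncated_integral_series (phi : C -> C) (c : Z -> C) (t eps : R) :
  abs_Laurent_expansion c phi -> 0 <= t <= 2 * PI -> 0 < eps ->
  exists l : C,
    is_series (V := C_NormedModule)
      (fun k => laurent_odd_pair c k (Cexpi t) * Ci
         * RtoC (dirichlet_tail k (arc_halfwidth eps)))%C l /\
    is_truncated_circle_int (fun zeta => phi zeta / (zeta - Cexpi t))%C (Cexpi t) eps l.
Proof.
intros [Hc Hphi] Ht He. set (z := Cexpi t).
set (h := fun k => truncated_integrand (fun zeta => laurent_pair c k zeta / (zeta - z))%C z eps).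
set (g := truncated_integrand (fun zeta => phi zeta / (zeta - z))%C z eps).
assert (Hlim : filterlim (fun M x => sum_n (G := C_AbelianMonoid) (fun k => h k x) M)
  eventually (locally (g : fct_UniformSpace R C_UniformSpace))).
(* On the retained arc 1 / |zeta - z| <= 1 / eps; elsewhere every term is 0. *)
{ apply weierstrass_M_test with (fun k => / eps * laurent_pair_bound c k).
  - intros k x. unfold h, truncated_integrand.
    assert (Hb := Cmod_laurent_pair c k (Cexpi x) (Cmod_Cexpi x)).
    assert (Hi : 0 < / eps) by now apply Rinv_0_lt_compat.
    assert (H0 := Cmod_ge_0 (laurent_pair c k (Cexpi x))).
    destruct (Rle_dec eps (Cmod (Cexpi x - z)%C)) as [H|H].
    + assert (Hnz : (Cexpi x - z)%C <> 0%C) by (apply Cmod_gt_0; lra).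
      unfold Cdiv. rewrite !Cmod_mult, Cmod_Ci, Cmod_Cexpi, Cmod_inv by exact Hnz.
      rewrite !Rmult_1_r, Rmult_comm.
      apply Rmult_le_compat; [|exact H0| |exact Hb].
      * apply Rlt_le, Rinv_0_lt_compat; lra.
      * now apply Rinv_le_contravar.
    + rewrite Cmod_0. apply Rmult_le_pos; lra.
  - apply (ex_series_scal (V := R_NormedModule) (/ eps)).
    now apply ex_series_laurent_pair_bound.
  - intros x. unfold h, g, truncated_integrand.
    destruct (Rle_dec eps (Cmod (Cexpi x - z)%C)) as [H|H].
    + assert (Hs := is_series_scal (/ (Cexpi x - z) * (Ci * Cexpi x))%C _ _
        (is_series_laurent_pair c (Cexpi x) _ (Hphi (Cexpi x) (Cmod_Cexpi x)))).
      assert (E : forall w : C, (w / (Cexpi x - z) * (Ci * Cexpi x))%C =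
        scal (/ (Cexpi x - z) * (Ci * Cexpi x))%C (w : C_NormedModule)).
      { intros w. unfold scal; simpl; unfold mult; simpl. unfold Cdiv. ring. }
      rewrite E. apply is_series_ext with (2 := Hs). intros k. symmetry. apply E.
    + assert (Hs := is_series_scal (RtoC 0) _ _
        (is_series_laurent_pair c (Cexpi x) _ (Hphi (Cexpi x) (Cmod_Cexpi x)))).
      assert (E : forall w : C, scal (RtoC 0) (w : C_NormedModule) = RtoC 0).
      { intros w. unfold scal; simpl; unfold mult; simpl. ring. }
      rewrite E in Hs. apply is_series_ext with (2 := Hs). intros k. apply E. }
destruct (filterlim_RInt (V := C_R_CompleteNormedModule)
  (fun M x => sum_n (G := C_AbelianMonoid) (fun k => h k x) M) 0 (2 * PI) eventually _ g
  (fun M => sum_n (G := C_AbelianMonoid) (fun k => laurent_odd_pair c k z * Ci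
         * RtoC (dirichlet_tail k (arc_halfwidth eps)))%C M)) as [l [Hl Hg]].
- intros M. apply (is_RInt_sum_n (V := C_R_NormedModule)). intros k.
  now apply is_RInt_truncated_pair.
- exact Hlim.
- exists l. split; [exact Hl | exact Hg].
Qed.

(** * Passage to the limit in the truncation parameter *)

Theorem mainTheorem10 :
  forall (phi : C -> C) (c : Z -> C),
    in_Wiener phi ->
    abs_Laurent_expansion c phi ->
    forall z : C, unit_circle z ->
      exists I S : C,
        is_VP_circle_int (fun zeta => (phi zeta / (zeta - z))%C) z I /\
        is_Zseries (V := C_NormedModule)
          (fun n => (eta n * c n * Cpowz z n)%C) S /\
        (RtoC (1 / PI) * I)%C = (Ci * S)%C.
Proof.
intros phi c _ Hphi z Hz.
destruct (Cexpi_surj z Hz) as [t [Ht ->]].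
set (z := Cexpi t).
set (term := fun k eps =>
  (laurent_odd_pair c k z * Ci * RtoC (dirichlet_tail k (arc_halfwidth eps)))%C).
(* A total function of eps is required; its values for eps <= 0 do not matter. *)
set (F := fun eps => RInt (V := C_R_CompleteNormedModule)
  (truncated_integrand (fun zeta => phi zeta / (zeta - z))%C z eps) 0 (2 * PI)).
assert (HF : forall eps, 0 < eps ->
  is_series (V := C_NormedModule) (fun k => term k eps) (F eps) /\
  is_truncated_circle_int (fun zeta => phi zeta / (zeta - z))%C z eps (F eps)).
{ intros eps He.
  destruct (truncated_integral_series phi c t eps Hphi Ht He) as [l [Hs Hl]].
  replace (F eps) with l; [now split|].
  symmetry. exact (is_RInt_unique (V := C_R_CompleteNormedModule) _ _ _ _ Hl). }
(* Exchange of the limits in M and eps: [at_right 0] is [locally 0] restricted to eps > 0, and the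
   partial sums converge uniformly on that domain. The first subgoal says that the domain
   accumulates at 0. *)
destruct (filterlim_switch_dom (U := C_CompleteNormedModule) eventually _ (locally 0) _
  (fun eps => 0 < eps)) with
  (f := fun M eps => sum_n (G := C_AbelianMonoid) (fun k => term k eps) M) (g := F)
  (h := fun M => sum_n (G := C_AbelianMonoid) (fun k => laurent_odd_pair c k z * Ci * RtoC PI)%C M)
  as [l [Hl HlF]].
- intros P [e He]. exists (e / 2). generalize (cond_pos e); intros Hpe.
  split; [lra|]. apply He. change (Rabs (e / 2 - 0) < e).
  rewrite Rminus_0_r, Rabs_pos_eq; lra.
- apply (weierstrass_M_test (fun k (y : {eps : R | 0 < eps}) => term k (proj1_sig y))
    (fun y => F (proj1_sig y)) (fun k => 12 * laurent_pair_bound c k)).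
  + intros k [eps He]; simpl. unfold term.
    rewrite !Cmod_mult, Cmod_Ci, Cmod_R, Rmult_1_r, Rmult_comm.
    generalize (arc_halfwidth_range eps He); intros Ha.
    apply Rmult_le_compat; [apply Rabs_pos | apply Cmod_ge_0 | |].
    * apply dirichlet_tail_bound; lra.
    * now apply Cmod_laurent_odd_pair.
  + apply (ex_series_scal (V := R_NormedModule) 12).
    apply ex_series_laurent_pair_bound, Hphi.
  + intros [eps He]. now apply HF.
- intros M. apply filterlim_sum_n. intros k.
  (* Multiplication by a real number is recast as real scaling, whose continuity in the scalar gives
     the limit. *)
  assert (E : forall r, (laurent_odd_pair c k z * Ci * RtoC r)%C
    = scal r (laurent_odd_pair c k z * Ci : C_R_NormedModule)%C).
  { intros r. unfold scal, Cmult, RtoC; simpl; unfold prod_scal, scal; simpl; unfold mult; simpl.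
    f_equal; ring. }
  rewrite E. apply filterlim_ext with
    (fun eps => scal (dirichlet_tail k (arc_halfwidth eps))
       (laurent_odd_pair c k z * Ci : C_R_NormedModule)%C).
  { intros eps. symmetry. apply E. }
  apply (filterlim_comp _ _ _ (fun eps => dirichlet_tail k (arc_halfwidth eps))
    (fun r => scal r (laurent_odd_pair c k z * Ci : C_R_NormedModule)%C)
    (at_right 0) (locally PI)); [apply dirichlet_tail_arc_lim|].
  apply (filterlim_scal_l (V := C_R_NormedModule)).
- assert (Hlp := proj2 Hphi z Hz). destruct Hlp as [lp [ln [Hp [Hn _]]]].
  (* [eta] is -1 exactly on the negative half, so that half sums to - ln. *)
  exists l, (lp - ln)%C. repeat split.
  + exists F. split; [intros eps He; now apply HF | exact HlF].
  + exists lp, (- ln)%C. repeat split.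
    * apply is_series_ext with (2 := Hp). intros k. unfold eta.
      destruct (Z_le_dec 0 (Z.of_nat k)); [C_ring | lia].
    * apply is_series_ext with (2 := is_series_opp _ _ Hn). intros k. unfold eta.
      destruct (Z_le_dec 0 (- Z.of_nat (S k))); [lia|].
      change (RtoC (-1)) with (RtoC (- (1))). rewrite RtoC_opp.
      unfold opp; simpl. C_ring.
  (* The series defining l also sums to i PI (lp - ln); uniqueness of limits identifies the two. *)
  + assert (Hs : is_series (V := C_NormedModule)
      (fun k => laurent_odd_pair c k z * Ci * RtoC PI)%C (Ci * RtoC PI * (lp - ln))%C).
    { apply is_series_ext with
        (2 := is_series_scal (Ci * RtoC PI)%C _ _ (is_series_minus _ _ _ _ Hp Hn)).
      intros k. unfold laurent_odd_pair, scal, minus, plus, opp; simpl; unfold mult; simpl.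
      C_ring. }
    rewrite (filterlim_locally_unique (V := C_NormedModule) (F := eventually) _ _ _ Hl Hs).
    assert (HPI : RtoC PI <> 0%C) by (intros E; apply RtoC_inj in E; generalize PI_RGT_0; lra).
    rewrite RtoC_div by (generalize PI_RGT_0; lra). field. exact HPI.
Qed.
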